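(* Let $\mathcal{F}$ be a real or complex Banach space, and let $\mathscr{L}(\mathcal{F})$ be the set of all linear bounded operators in $\mathcal{F}$. Suppose that a linear operator $L\colon \mathcal{F}\supset D(L)\to\mathcal{F}$ generates a $C_0$-semigroup $(e^{tL})_{t\geq 0}$ satisfying, for some constants $M\geq 1$ and $\omega\geq 0$, the inequality $\|e^{tL}\|\leq Me^{\omega t}$ for all $t\geq 0$. Suppose that a function $S\colon [0,+\infty)\to \mathscr{L}(\mathcal{F})$ is given and $\|S(t)^k\|\leq Me^{\omega tk}$ for all $t\geq 0$ and all $k=1,2,3,\dots$. Denote the resolvent of $(L,D(L))$ by $R_\lambda=(\lambda I-L)^{-1}$ for all $\lambda\in\rho(L)$. Suppose that a number $\lambda\in\mathbb{C}$ is given and $\mathrm{Re}\,\lambda>\omega$. Then $\lambda\in\rho(L)$ and: 1. If for all $T>0$ we have $\lim_{n\to\infty}\sup_{t\in[0,T]}\left\|e^{tL}f - (S(t/n))^nf \right\|=0$ for all $f\in\mathcal{F}$, then for all $f\in\mathcal{F}$ we have $$\lim_{n\to\infty}\left\|R_\lambda f - \int_0^\infty e^{-\lambda t}(S(t/n))^nf\,dt \right\|=0.$$ 2. If for all $T>0$ we have $\lim_{n\to\infty}\sup_{t\in[0,T]}\left\|e^{tL} - (S(t/n))^n \right\|=0$, then we have $$\lim_{n\to\infty}\left\|R_\lambda - \int_0^\infty e^{-\lambda t}(S(t/n))^n\,dt \right\|=0.$$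
   Context: A $C_0$-semigroup on a Banach space $\mathcal{F}$ is a family $(V(t))_{t\ge 0}$ of bounded linear operators in $\mathcal{F}$ with $V(0)=I$ (the identity operator), $V(t+s)=V(t)V(s)$ for all $t,s\ge 0$, and $t\mapsto V(t)\varphi$ continuous on $[0,+\infty)$ for each $\varphi\in\mathcal{F}$. Its generator is the operator $L\varphi=\lim_{t\to+0}(V(t)\varphi-\varphi)/t$ whose domain $D(L)$ is the set of all $\varphi\in\mathcal{F}$ for which this limit exists; one writes $V(t)=e^{tL}$. $(S(t/n))^n$ denotes the composition of $n$ copies of the operator $S(t/n)$. $\rho(L)$ is the resolvent set of $L$, i.e. the set of numbers $\lambda$ for which $\lambda I-L\colon D(L)\to\mathcal{F}$ is bijective with bounded inverse. The norm of a vector is the norm of $\mathcal{F}$, and the norm of an operator is the operator norm. The integrals are understood as improper Riemann integrals.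
   Formalization: Since S is arbitrary, the integrals need not exist; for all large n the integrand e^{-λt}(S(t/n))^n f is assumed Riemann integrable on every [0,b]. For real F, λ is taken real. The operator integral in part 2 is understood strongly. *)

(* Defs.v *)
From Stdlib Require Export Reals.
From Coquelicot Require Export Coquelicot.
Open Scope R_scope.

Inductive ground : Set := RealScalars | ComplexScalars.

Definition scalars (k : ground) : AbsRing :=
  match k with RealScalars => R_AbsRing | ComplexScalars => C_AbsRing end.

Definition of_real {k : ground} : R -> scalars k :=
  match k return R -> scalars k with
  | RealScalars => fun r => r
  | ComplexScalars => RtoC
  end.

Definition re {k : ground} : scalars k -> R :=
  match k return scalars k -> R with
  | RealScalars => fun r => r
  | ComplexScalars => fun z : C => Complex.Re z
  end.

Definition exp_scalar {k : ground} : scalars k -> scalars k :=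
  match k return scalars k -> scalars k with
  | RealScalars => exp
  | ComplexScalars => fun z : C =>
      (exp (Complex.Re z) * cos (Complex.Im z),
       exp (Complex.Re z) * sin (Complex.Im z))
  end.

Definition Banach (k : ground) : Type := CompleteNormedModule (scalars k).

Lemma of_real_mult (k : ground) (x y : R) :
  of_real (k := k) (x * y) = mult (of_real x) (of_real y).
Proof. destruct k; [reflexivity | exact (RtoC_mult x y)]. Qed.

Lemma of_real_plus (k : ground) (x y : R) :
  of_real (k := k) (x + y) = plus (of_real x) (of_real y).
Proof. destruct k; [reflexivity | exact (RtoC_plus x y)]. Qed.

Lemma of_real_one (k : ground) : of_real (k := k) 1 = one.
Proof. destruct k; reflexivity. Qed.

Lemma abs_of_real (k : ground) (x : R) : abs (of_real (k := k) x) = Rabs x.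
Proof. destruct k; [reflexivity | exact (Cmod_R x)]. Qed.

(* Restriction of scalars to R, same norm and uniform structure: Coquelicot's
   Riemann integral takes its values in real normed modules only. *)
Section Realify.
Context {k : ground} (F : Banach k).

Definition realify_ModuleSpace_mixin : ModuleSpace.mixin_of R_Ring F.
Proof.
refine (ModuleSpace.Mixin R_Ring F
          (fun (r : R) (x : F) => scal (of_real (k := k) r) x) _ _ _ _).
- intros x y u; rewrite scal_assoc, <- of_real_mult; reflexivity.
- intros u; change (@one R_Ring) with 1; rewrite of_real_one; apply scal_one.
- intros x u v.
  exact (scal_distr_l (V := CompleteNormedModule.ModuleSpace _ F)
           (of_real (k := k) x) u v).
- intros x y u; change (@plus R_Ring x y) with (x + y).
  rewrite of_real_plus.
  exact (scal_distr_r (V := CompleteNormedModule.ModuleSpace _ F) _ _ u).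
Defined.

Definition realify_NormedModuleAux : NormedModuleAux R_AbsRing :=
  NormedModuleAux.Pack R_AbsRing F
    (NormedModuleAux.Class R_AbsRing F
       (ModuleSpace.Class R_Ring F (AbelianGroup.class F)
          realify_ModuleSpace_mixin)
       (UniformSpace.class F)) F.

Definition realify_NormedModule_mixin :
  NormedModule.mixin_of R_AbsRing realify_NormedModuleAux.
Proof.
refine (NormedModule.Mixin R_AbsRing realify_NormedModuleAux
          (fun x : F => norm x) (@norm_factor (scalars k) F) _ _ _ _ _).
- intros x y; exact (norm_triangle (x : F) y).
- intros l x; change (@abs R_AbsRing l) with (Rabs l).
  rewrite <- (abs_of_real k l); exact (norm_scal (of_real (k := k) l) (x : F)).
- intros x y eps; exact (norm_compat1 (x : F) y eps).
- intros x y eps; exact (norm_compat2 (x : F) y eps).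
- intros x; exact (norm_eq_zero (x : F)).
Defined.

Definition realify : CompleteNormedModule R_AbsRing :=
  CompleteNormedModule.Pack R_AbsRing F
    (CompleteNormedModule.Class R_AbsRing F
       (NormedModule.Class R_AbsRing F
          (NormedModuleAux.class R_AbsRing realify_NormedModuleAux)
          realify_NormedModule_mixin)
       (CompleteSpace.class F)) F.

End Realify.

(* Values in [Rbar], so that an unbounded operator has norm [p_infty]. *)
Definition op_norm {k : ground} {F : Banach k} (A : F -> F) : Rbar :=
  Lub_Rbar (fun r => exists x : F, norm x <= 1 /\ r = norm (A x)).

Definition op_minus {k : ground} {F : Banach k} (A B : F -> F) : F -> F :=
  fun x => minus (A x) (B x).

Definition sup_on (T : R) (g : R -> Rbar) : Rbar :=
  Rbar_lub (fun r => exists t : R, 0 <= t <= T /\ r = g t).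

Definition tends_to_0 (u : nat -> Rbar) : Prop :=
  forall eps : posreal,
    eventually (fun n => Rbar_lt (- eps) (u n) /\ Rbar_lt (u n) eps).

(* Only the values for nonnegative times are constrained.  Here and in Coquelicot
   [is_linear] includes boundedness. *)
Record C0_semigroup {k : ground} {F : Banach k} (V : R -> F -> F) : Prop := {
  C0_bounded : forall t, 0 <= t -> is_linear (V t);
  C0_zero : forall x, V 0 x = x;
  C0_plus : forall t s, 0 <= t -> 0 <= s -> forall x, V (t + s) x = V t (V s x);
  C0_continuous : forall (x : F) (t : R), 0 <= t ->
    filterlim (fun s => V s x) (within (fun s => 0 <= s) (locally t))
      (locally (V t x))
}.

(* An unbounded operator is a domain [D] with a map [L] whose values outside
   [D] are irrelevant. *)
Section Unbounded.
Context {k : ground} {F : Banach k}.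

Definition is_generator (V : R -> F -> F) (D : F -> Prop) (L : F -> F) : Prop :=
  let derivative_at_0 (x y : F) :=
    filterlim (fun t => scal (of_real (k := k) (/ t)) (minus (V t x) x))
      (at_right 0) (locally y) in
  (forall x, D x <-> exists y, derivative_at_0 x y) /\
  (forall x, D x -> derivative_at_0 x (L x)).

Definition is_resolvent (D : F -> Prop) (L : F -> F) (lam : scalars k)
    (Rlam : F -> F) : Prop :=
  is_linear Rlam /\
  (forall f, D (Rlam f) /\ minus (scal lam (Rlam f)) (L (Rlam f)) = f) /\
  (forall x, D x -> Rlam (minus (scal lam x) (L x)) = x).

Definition resolvent_set (D : F -> Prop) (L : F -> F) (lam : scalars k) : Prop :=
  exists Rlam, is_resolvent D L lam Rlam.

Definition chernoff (S : R -> F -> F) (n : nat) (t : R) : F -> F :=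
  Nat.iter n (S (t / INR n)).

Definition laplace_integrand (lam : scalars k) (S : R -> F -> F) (n : nat)
    (f : F) (t : R) : realify F :=
  scal (exp_scalar (opp (mult lam (of_real t)))) (chernoff S n t f).

Definition laplace_converges (lam : scalars k) (S : R -> F -> F) (n : nat)
    (f : F) : Prop :=
  ex_RInt_gen (laplace_integrand lam S n f) (at_point 0) (Rbar_locally p_infty).

(* As an operator, [laplace lam S n] is the integral in the strong sense. *)
Definition laplace (lam : scalars k) (S : R -> F -> F) (n : nat) (f : F) : F :=
  RInt_gen (laplace_integrand lam S n f) (at_point 0) (Rbar_locally p_infty).

Definition locally_integrable (lam : scalars k) (S : R -> F -> F) (n : nat)
    (f : F) : Prop :=
  forall b : R, 0 < b -> ex_RInt (laplace_integrand lam S n f) 0 b.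

End Unbounded.

(* Main.v *)
From Stdlib Require Import Lra Lia ssreflect.
Require Import Defs.

(** Write [V t] for the semigroup, [delta = re lam - omega > 0] and
    [U t = exp (- lam t) V t].  The family [U] is again a strongly continuous
    semigroup, its generator is [L - lam], and [norm (U t f)] is at most
    [M * norm f * exp (- delta t)].  Everything rests on two facts.

    The Laplace transform [J f], the integral of [U t f] over the half-line, is
    the resolvent.  Shifting the variable of integration gives
    [J (U h f) = J f - (integral of U t f over [0, h])], and [U h] commutes with
    the integral, so both [(U h (J f) - J f) / h] and [J ((U h f - f) / h)] are
    minus the average of the orbit over [0, h], which tends to [- f].  The first
    limit says that [J f] lies in the domain and that [(L - lam) (J f) = - f];
    the second one, together with the boundedness of [J], says that
    [J ((L - lam) x) = - x] for [x] in the domain.  See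
    [orbit_integral_derivative], [orbit_integral_of_derivative] and
    [laplace_semigroup_resolvent].

    The Chernoff approximations have the same decay: the power bound on [S] at
    time [t / n] and exponent [n] is [M exp (omega t)], uniformly in [n].  Hence
    their Laplace integrals converge as soon as they are locally integrable, and
    the difference with [J f] splits at a time [T].  Beyond [T] both tails are
    at most [(M * norm f / delta) * exp (- delta T)], uniformly in [n]; on [0, T]
    the weight has modulus at most one, so the contribution is at most [T] times
    the supremum of the difference over [0, T].  Choosing first [T] and then [n]
    gives both limits, since for the operator norm the estimate is uniform over
    the unit ball.  See [laplace_error] and [split_error].

    The semigroup [U] is studied over the real scalars, over which the integral
    takes its values; linearity over the complex field follows afterwards,
    because multiplication by a scalar commutes with [U t]. *)

(** * Normed modules *)

Lemma norm_minus_sym {K : AbsRing} {E : NormedModule K} (x y : E) :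
  norm (minus x y) = norm (minus y x).
Proof. rewrite -opp_minus; apply norm_opp. Qed.

Lemma norm_minus_triangle {K : AbsRing} {E : NormedModule K} (x y z : E) :
  norm (minus x z) <= norm (minus x y) + norm (minus y z).
Proof. rewrite (minus_trans y x z); apply norm_triangle. Qed.

Lemma minus_minus_l {G : AbelianGroup} (a b : G) : minus (minus a b) a = opp b.
Proof.
  rewrite /minus (plus_comm a) -plus_assoc plus_opp_r.
  apply plus_zero_r.
Qed.

Lemma norm_le_of_filterlim {T : Type} {E : NormedModule R_AbsRing}
    (G : (T -> Prop) -> Prop) (f : T -> E) (l : E) (c : R) :
  ProperFilter' G -> G (fun x => norm (f x) <= c) ->
  filterlim f G (locally l) -> norm l <= c.
Proof.
  intros PG Hle Hlim.
  change (Rbar_le (norm l) c).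
  apply (filterlim_le (F := G) (fun x => norm (f x)) (fun _ => c)); auto.
  - apply (filterlim_comp _ _ _ f norm G (locally l)); auto.
    apply filterlim_norm.
  - apply filterlim_const.
Qed.

Lemma filterlim_minus_const {T : Type} {K : AbsRing} {E : NormedModule K}
    (G : (T -> Prop) -> Prop) (FG : Filter G) (f : T -> E) (l c : E) :
  filterlim f G (locally l) ->
  filterlim (fun t => minus (f t) c) G (locally (minus l c)).
Proof.
  intros Hf.
  apply (filterlim_comp_2 f (fun _ => opp c) plus Hf (filterlim_const _)).
  apply: filterlim_plus.
Qed.

(** * Integrals over the half-line *)

(** The improper integral as a limit of the total function [RInt], with
    integrability on bounded intervals kept separate.  It is easier to
    manipulate than [is_RInt_gen], whose integrals are given by a relation. *)
Definition integral_to_infinity {E : CompleteNormedModule R_AbsRing}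
    (g : R -> E) (l : E) : Prop :=
  (forall b, 0 < b -> ex_RInt g 0 b) /\
  filterlim (fun b => RInt g 0 b) (Rbar_locally p_infty) (locally l).

Lemma near_infinity (T : R) (P : R -> Prop) :
  (forall b, T < b -> P b) -> Rbar_locally p_infty P.
Proof. now exists T. Qed.

Section Improper.
Context {E : CompleteNormedModule R_AbsRing}.
Implicit Types (g : R -> E) (l x : E).

Lemma ex_RInt_between g a b : (forall c, 0 < c -> ex_RInt g 0 c) ->
  0 <= a -> 0 <= b -> ex_RInt g a b.
Proof.
  intros H Ha Hb.
  assert (H0 : forall c, 0 <= c -> ex_RInt g 0 c).
  { intros c [Hc | <-]; [now apply H | apply ex_RInt_point]. }
  apply ex_RInt_Chasles with 0; auto.
  apply ex_RInt_swap; auto.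
Qed.

Lemma integral_to_infinity_gen g l : integral_to_infinity g l ->
  is_RInt_gen g (at_point 0) (Rbar_locally p_infty) l.
Proof.
  intros [Hex Hlim] P HP.
  destruct (Hlim P HP) as [T HT].
  apply (Filter_prod _ _ _ (fun a => a = 0) (fun b => Rmax 0 T < b)).
  - reflexivity.
  - now exists (Rmax 0 T).
  - intros a b -> Hb; exists (RInt g 0 b); split.
    + apply (RInt_correct (V := E)), Hex.
      pose proof (Rmax_l 0 T); simpl; lra.
    + apply HT; pose proof (Rmax_r 0 T); lra.
Qed.

Lemma integral_to_infinity_RInt_gen g l : integral_to_infinity g l ->
  RInt_gen g (at_point 0) (Rbar_locally p_infty) = l.
Proof.
  intros H; apply is_RInt_gen_unique; now apply integral_to_infinity_gen.
Qed.

Lemma integral_to_infinity_unique g l l' :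
  integral_to_infinity g l -> integral_to_infinity g l' -> l = l'.
Proof. intros [_ H] [_ H']; exact (filterlim_locally_unique _ _ _ H H'). Qed.

(** Lets the primitive be any explicit function, so that the algebraic rules
    below reduce to those of [is_RInt] on bounded intervals. *)
Lemma integral_to_infinity_intro g (G : R -> E) l :
  (forall b, 0 < b -> is_RInt g 0 b (G b)) ->
  filterlim G (Rbar_locally p_infty) (locally l) ->
  integral_to_infinity g l.
Proof.
  intros HG Hl; split.
  - intros b Hb; exists (G b); auto.
  - apply: (filterlim_ext_loc G); auto.
    apply (near_infinity 0); intros b Hb; symmetry; apply is_RInt_unique; auto.
Qed.

Lemma integral_to_infinity_is_RInt g l b : integral_to_infinity g l -> 0 < b ->
  is_RInt g 0 b (RInt g 0 b).
Proof. intros [Hex _] Hb; now apply (RInt_correct (V := E)), Hex. Qed.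

Lemma integral_to_infinity_ext g g' l : (forall t, 0 < t -> g t = g' t) ->
  integral_to_infinity g l -> integral_to_infinity g' l.
Proof.
  intros Heq H; apply integral_to_infinity_intro with (fun b => RInt g 0 b).
  - intros b Hb; apply (is_RInt_ext (V := E) g).
    + intros t; rewrite -> Rmin_left by lra; intros [Ht _]; auto.
    + now apply integral_to_infinity_is_RInt with l.
  - apply H.
Qed.

(** A bounded operator maps Riemann sums to Riemann sums and passes to the
    limit by continuity. *)
Lemma is_RInt_linear (A : E -> E) g a b l : is_linear A ->
  is_RInt g a b l -> is_RInt (fun t => A (g t)) a b (A l).
Proof.
  intros HA Hg.
  apply filterlim_ext with
    (fun ptd => A (scal (sign (b - a)) (Riemann_sum g ptd))).
  - intros ptd; rewrite (linear_scal _ HA); f_equal.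
    induction ptd as [x0 | h ptd IH] using SF_cons_ind.
    + exact (linear_zero _ HA).
    + by rewrite !Riemann_sum_cons (linear_plus _ HA) (linear_scal _ HA) IH.
  - apply (filterlim_comp _ _ _ _ A _ (locally l)); [exact Hg |].
    now apply (linear_cont A l).
Qed.

Lemma integral_to_infinity_linear (A : E -> E) g l : is_linear A ->
  integral_to_infinity g l -> integral_to_infinity (fun t => A (g t)) (A l).
Proof.
  intros HA H; apply integral_to_infinity_intro with (fun b => A (RInt g 0 b)).
  - intros b Hb; apply is_RInt_linear; auto.
    now apply integral_to_infinity_is_RInt with l.
  - apply (filterlim_comp _ _ _ _ A _ (locally l)); [apply H |].
    now apply (linear_cont A l).
Qed.

Lemma integral_to_infinity_plus g g' l l' :
  integral_to_infinity g l -> integral_to_infinity g' l' ->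
  integral_to_infinity (fun t => plus (g t) (g' t)) (plus l l').
Proof.
  intros H H'.
  apply integral_to_infinity_intro with
    (fun b => plus (RInt g 0 b) (RInt g' 0 b)).
  - intros b Hb; apply: is_RInt_plus;
      [apply: (integral_to_infinity_is_RInt g l)
      | apply: (integral_to_infinity_is_RInt g' l')]; auto.
  - apply: (filterlim_comp_2 (H := locally l')); [apply H | apply H' |].
    apply: filterlim_plus.
Qed.

Lemma integral_to_infinity_shift g l h : 0 <= h -> integral_to_infinity g l ->
  integral_to_infinity (fun t => g (t + h)) (minus l (RInt g 0 h)).
Proof.
  intros Hh [Hex Hlim].
  apply integral_to_infinity_intro with
    (fun b => minus (RInt g 0 (b + h)) (RInt g 0 h)).
  - intros b Hb.
    assert (Hint : is_RInt g h (b + h) (minus (RInt g 0 (b + h)) (RInt g 0 h))).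
    { rewrite /minus plus_comm. apply: (is_RInt_Chasles _ _ 0). 
      - apply: is_RInt_swap; apply: RInt_correct.
        apply ex_RInt_between; auto; lra.
      - apply: RInt_correct; apply Hex; lra. }
    apply: (is_RInt_ext (fun t => scal 1 (g (1 * t + h)))).
    + intros t _; rewrite Rmult_1_l; apply: scal_one.
    + apply: is_RInt_comp_lin; rewrite Rmult_0_r Rplus_0_l Rmult_1_l.
      exact Hint.
  - apply: filterlim_minus_const.
    apply: (filterlim_comp _ _ _ (fun b => b + h) (fun b => RInt g 0 b) _
              (Rbar_locally p_infty)); auto.
    intros P [T HT]; exists (T - h); intros b Hb; apply HT; lra.
Qed.

Lemma is_RInt_exp_decay C delta a b : 0 < delta ->
  is_RInt (fun t => C * exp (- (delta * t))) a b
    (C / delta * (exp (- (delta * a)) - exp (- (delta * b)))).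
Proof.
  intros Hd.
  replace (C / delta * _) with
    (minus (- (C / delta) * exp (- (delta * b))) (- (C / delta) * exp (- (delta * a))))
    by (rewrite /minus /plus /opp /=; ring).
  apply: (is_RInt_derive (fun t => - (C / delta) * exp (- (delta * t)))).
  - intros t _; auto_derive; [trivial | field; lra].
  - intros t _; apply: ex_derive_continuous; auto_derive; trivial.
Qed.

(** The bound depends on [a] only.  This makes the integrals over [0, b]
    a Cauchy family and, for [b] tending to infinity, controls the tail. *)
Lemma norm_RInt_exp_decay g C delta a b : 0 < delta -> 0 <= C ->
  (forall c, 0 < c -> ex_RInt g 0 c) ->
  (forall t, 0 <= t -> norm (g t) <= C * exp (- (delta * t))) ->
  0 <= a <= b ->
  norm (minus (RInt g 0 b) (RInt g 0 a)) <= C / delta * exp (- (delta * a)).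
Proof.
  intros Hd HC Hex Hg Hab.
  apply Rle_trans with
    (C / delta * (exp (- (delta * a)) - exp (- (delta * b)))).
  - apply (norm_RInt_le g (fun t => C * exp (- (delta * t))) a b); [lra | | |].
    + intros t Ht; apply Hg; lra.
    + rewrite /minus plus_comm; apply: (is_RInt_Chasles _ _ 0).
      * apply: is_RInt_swap; apply: RInt_correct.
        apply ex_RInt_between; auto; lra.
      * apply: RInt_correct; apply ex_RInt_between; auto; lra.
    + now apply is_RInt_exp_decay.
  - apply Rmult_le_compat_l.
    + apply Rle_mult_inv_pos; lra.
    + pose proof (exp_pos (- (delta * b))); lra.
Qed.

Lemma exp_decay_small K delta eps : 0 < delta -> 0 <= K -> 0 < eps ->
  exists T, 0 < T /\ forall t, T <= t -> K * exp (- (delta * t)) < eps.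
Proof.
  intros Hd HK He.
  assert (HT : 0 <= K / (delta * eps)).
  { apply Rle_mult_inv_pos; auto; now apply Rmult_lt_0_compat. }
  (* From [1 + delta * t <= exp (delta * t)], it suffices that
     [K < eps * (1 + delta * T)]. *)
  exists (K / (delta * eps) + 1); split; [lra |]; intros t Ht.
  rewrite exp_Ropp.
  apply (Rmult_lt_reg_r (exp (delta * t))); [apply exp_pos |].
  rewrite Rmult_assoc Rinv_l; [| apply Rgt_not_eq, exp_pos].
  apply Rlt_le_trans with (eps * (1 + delta * t)).
  - apply Rlt_le_trans with (eps * (delta * (K / (delta * eps)) + 1)).
    + replace (eps * _) with (K + eps) by (field; lra); lra.
    + apply Rmult_le_compat_l; [lra |].
      assert (delta * (K / (delta * eps)) <= delta * t)
        by (apply Rmult_le_compat_l; lra).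
      lra.
  - apply Rmult_le_compat_l; [lra | apply exp_ineq1_le].
Qed.

Lemma exp_decay_integrable g C delta : 0 < delta -> 0 <= C ->
  (forall b, 0 < b -> ex_RInt g 0 b) ->
  (forall t, 0 <= t -> norm (g t) <= C * exp (- (delta * t))) ->
  exists l, integral_to_infinity g l.
Proof.
  intros Hd HC Hex Hg.
  destruct (proj1 (filterlim_locally_cauchy (F := Rbar_locally p_infty)
    (fun b => RInt g 0 b))) as [l Hl]; [| now exists l].
  intros eps.
  destruct (exp_decay_small (C / delta) delta eps) as [T [HT0 HT]];
    [auto | apply Rle_mult_inv_pos; lra | apply cond_pos |].
  assert (Hle : forall a b, T < a <= b -> norm (minus (RInt g 0 b) (RInt g 0 a)) < eps).
  { intros a b Hab; eapply Rle_lt_trans; [| apply (HT a); lra].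
    apply norm_RInt_exp_decay; auto; lra. }
  exists (fun b => T < b); split; [now exists T |].
  intros a b Ha Hb; apply: norm_compat1.
  destruct (Rle_dec a b); [| rewrite norm_minus_sym]; apply Hle; lra.
Qed.

Lemma integral_to_infinity_tail g l C delta T : 0 < delta -> 0 <= C ->
  (forall t, 0 <= t -> norm (g t) <= C * exp (- (delta * t))) ->
  integral_to_infinity g l -> 0 <= T ->
  norm (minus l (RInt g 0 T)) <= C / delta * exp (- (delta * T)).
Proof.
  intros Hd HC Hg [Hex Hlim] HT.
  apply (norm_le_of_filterlim (Rbar_locally p_infty)
    (fun b => minus (RInt g 0 b) (RInt g 0 T))).
  - apply Proper_StrongProper, Rbar_locally_filter.
  - apply (near_infinity T); intros b Hb; apply norm_RInt_exp_decay; auto; lra.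
  - now apply: filterlim_minus_const.
Qed.

Lemma norm_integral_to_infinity g l C delta : 0 < delta -> 0 <= C ->
  (forall t, 0 <= t -> norm (g t) <= C * exp (- (delta * t))) ->
  integral_to_infinity g l -> norm l <= C / delta.
Proof.
  intros Hd HC Hg Hl.
  pose proof (integral_to_infinity_tail g l C delta 0 Hd HC Hg Hl (Rle_refl 0)) as H.
  rewrite RInt_point in H.
  by rewrite minus_zero_r Rmult_0_r Ropp_0 exp_0 Rmult_1_r in H.
Qed.

(** Cutting at [T]: closeness of the integrands is needed only on a bounded
    interval, the common decay takes care of the rest. *)
Lemma norm_integral_to_infinity_minus g g' l l' C delta T eta :
  0 < delta -> 0 <= C -> 0 <= T ->
  (forall t, 0 <= t -> norm (g t) <= C * exp (- (delta * t))) ->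
  (forall t, 0 <= t -> norm (g' t) <= C * exp (- (delta * t))) ->
  (forall t, 0 <= t <= T -> norm (minus (g t) (g' t)) <= eta) ->
  integral_to_infinity g l -> integral_to_infinity g' l' ->
  norm (minus l l') <= T * eta + 2 * (C / delta) * exp (- (delta * T)).
Proof.
  intros Hd HC HT Hg Hg' Heta Hl Hl'.
  assert (Htail : norm (minus l (RInt g 0 T)) <= C / delta * exp (- (delta * T)))
    by now apply integral_to_infinity_tail.
  assert (Htail' : norm (minus (RInt g' 0 T) l') <= C / delta * exp (- (delta * T)))
    by (rewrite norm_minus_sym; now apply integral_to_infinity_tail).
  assert (Hmid : norm (minus (RInt g 0 T) (RInt g' 0 T)) <= T * eta).
  { replace (T * eta) with ((T - 0) * eta) by ring.
    apply (norm_RInt_le_const (fun t => minus (g t) (g' t)) 0 T); auto.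
    apply: is_RInt_minus; apply: RInt_correct; apply ex_RInt_between;
      solve [apply Hl | apply Hl' | lra]. }
  eapply Rle_trans; [apply (norm_minus_triangle l (RInt g 0 T) l') |].
  eapply Rle_trans; [apply Rplus_le_compat; [exact Htail |] |].
  - eapply Rle_trans; [apply (norm_minus_triangle _ (RInt g' 0 T)) |].
    apply Rplus_le_compat; [exact Hmid | exact Htail'].
  - lra.
Qed.

(** The fundamental theorem of calculus at the endpoint of the half-line, where
    only one-sided continuity is available. *)
Lemma average_at_0 g x : (forall b, 0 < b -> ex_RInt g 0 b) ->
  g 0 = x -> filterlim g (at_right 0) (locally x) ->
  filterlim (fun h => scal (/ h) (RInt g 0 h)) (at_right 0) (locally x).
Proof.
  intros Hex Hg0 Hg.
  apply (proj2 (filterlim_locally_ball_norm (U := E) _ _)); intros eps.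
  destruct (proj1 (filterlim_locally_ball_norm (U := E) g x) Hg (pos_div_2 eps)) as [d Hd].
  exists d; intros h Hh Hh0.
  assert (Hint : is_RInt (fun t => minus (g t) x) 0 h
                   (minus (RInt g 0 h) (scal (h - 0) x))).
  { apply: is_RInt_minus; [apply: RInt_correct; now apply Hex | apply: is_RInt_const]. }
  assert (Hle : norm (minus (RInt g 0 h) (scal h x)) <= h * (eps / 2)).
  { rewrite Rminus_0_r in Hint.
    replace (h * (eps / 2)) with ((h - 0) * (eps / 2)) by ring.
    apply (norm_RInt_le_const (fun t => minus (g t) x) 0 h); [lra | | exact Hint].
    intros t [[Ht | <-] Hth].
    - apply Rlt_le, (Hd t); [| exact Ht].
      apply: norm_compat1 => /=; rewrite /minus /plus /opp /norm /abs /= /abs /=.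
      rewrite /ball /= /AbsRing_ball /minus /plus /opp /abs /= in Hh.
      rewrite -> Rabs_pos_eq in * by lra; lra.
    - rewrite Hg0 minus_eq_zero norm_zero; pose proof (cond_pos eps); lra. }
  assert (Heq : minus (scal (/ h) (RInt g 0 h)) x =
                scal (/ h) (minus (RInt g 0 h) (scal h x))).
  { rewrite scal_minus_distr_l scal_assoc; f_equal.
    rewrite /mult /= Rinv_l; [symmetry; apply: scal_one | lra]. }
  rewrite /ball_norm Heq.
  eapply Rle_lt_trans; [apply (norm_scal (V := E)) |].
  rewrite /abs /= Rabs_pos_eq; [| apply Rlt_le, Rinv_0_lt_compat; lra].
  apply Rle_lt_trans with (/ h * (h * (eps / 2))).
  - apply Rmult_le_compat_l; [apply Rlt_le, Rinv_0_lt_compat; lra | exact Hle].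
  - rewrite -Rmult_assoc Rinv_l; [| lra]. pose proof (cond_pos eps); lra.
Qed.

End Improper.

(** * Exponentially decaying semigroups *)

Record decaying_semigroup {E : CompleteNormedModule R_AbsRing}
    (U : R -> E -> E) (C delta : R) : Prop := {
  decaying_linear : forall t, 0 <= t -> is_linear (U t);
  decaying_zero : forall x, U 0 x = x;
  decaying_plus : forall t s, 0 <= t -> 0 <= s ->
    forall x, U (t + s) x = U t (U s x);
  decaying_cont : forall x t, 0 <= t ->
    filterlim (fun s => U s x) (within (fun s => 0 <= s) (locally t))
      (locally (U t x));
  decaying_bound : forall t x, 0 <= t ->
    norm (U t x) <= C * norm x * exp (- (delta * t))
}.

Definition orbit_integral {E : CompleteNormedModule R_AbsRing}
    (U : R -> E -> E) (x : E) : E :=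
  RInt_gen (fun t => U t x) (at_point 0) (Rbar_locally p_infty).

Section Decaying.
Context {E : CompleteNormedModule R_AbsRing} (U : R -> E -> E) (C delta : R).
Context (delta_pos : 0 < delta) (C_nonneg : 0 <= C).
Context (HU : decaying_semigroup U C delta).

(** Replacing [t] by [Rmax 0 t] turns continuity on the half-line into
    two-sided continuity at every point without changing the integral. *)
Lemma orbit_integrable x b : 0 < b -> ex_RInt (fun t => U t x) 0 b.
Proof.
  intros Hb.
  apply (ex_RInt_ext (V := E) (fun t => U (Rmax 0 t) x)).
  - intros t; rewrite -> Rmin_left by lra; intros [Ht _].
    rewrite -> Rmax_right; auto; lra.
  - apply ex_RInt_continuous; intros t _.
    apply: (filterlim_comp _ _ _ (fun s => Rmax 0 s) (fun s => U s x) _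
              (within (fun s => 0 <= s) (locally (Rmax 0 t)))).
    + intros P [d Hd]; exists d; intros s Hs.
      apply Hd; [| apply Rmax_l].
      revert Hs; rewrite /ball /= /AbsRing_ball /minus /plus /opp /abs /= => Hs.
      eapply Rle_lt_trans; [| exact Hs].
      unfold Rmax; destruct (Rle_dec 0 s), (Rle_dec 0 t);
        unfold Rabs; repeat destruct Rcase_abs; lra.
    + apply (decaying_cont _ _ _ HU), Rmax_l.
Qed.

Lemma orbit_at_0 x : filterlim (fun t => U t x) (at_right 0) (locally x).
Proof.
  rewrite -{2}(decaying_zero _ _ _ HU x).
  apply: filterlim_filter_le_1; [| apply: (decaying_cont _ _ _ HU x 0 (Rle_refl 0))].
  intros P [d Hd]; exists d; intros t Ht Ht0; apply Hd; auto; lra.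
Qed.

Lemma orbit_integral_correct x :
  integral_to_infinity (fun t => U t x) (orbit_integral U x).
Proof.
  destruct (exp_decay_integrable (fun t => U t x) (C * norm x) delta) as [l Hl].
  - exact delta_pos.
  - apply Rmult_le_pos; [exact C_nonneg | apply norm_ge_0].
  - apply orbit_integrable.
  - intros t Ht; now apply (decaying_bound _ _ _ HU).
  - unfold orbit_integral; now rewrite (integral_to_infinity_RInt_gen _ _ Hl).
Qed.

Lemma orbit_integral_plus x y :
  orbit_integral U (plus x y) = plus (orbit_integral U x) (orbit_integral U y).
Proof.
  apply: integral_to_infinity_unique; [apply orbit_integral_correct |].
  apply (integral_to_infinity_ext (fun t => plus (U t x) (U t y))).
  - intros t Ht; symmetry; apply (linear_plus (U t)), (decaying_linear _ _ _ HU); lra.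
  - apply integral_to_infinity_plus; apply orbit_integral_correct.
Qed.

(** Used for the operators [U h] and for the multiplications by scalars; with
    complex scalars the latter give linearity over the larger field. *)
Lemma orbit_integral_commute (A : E -> E) x : is_linear A ->
  (forall t y, 0 < t -> U t (A y) = A (U t y)) ->
  orbit_integral U (A x) = A (orbit_integral U x).
Proof.
  intros HA Hcom.
  apply: integral_to_infinity_unique; [apply orbit_integral_correct |].
  apply (integral_to_infinity_ext (fun t => A (U t x))).
  - intros t Ht; symmetry; auto.
  - apply integral_to_infinity_linear; auto; apply orbit_integral_correct.
Qed.

Lemma orbit_integral_linear : is_linear (orbit_integral U).
Proof.
  split.
  - apply orbit_integral_plus.
  - intros a x; apply (orbit_integral_commute (fun y => scal a y)).
    + apply: is_linear_scal_r; intros; apply Rmult_comm.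
    + intros t y Ht; apply (linear_scal (U t)), (decaying_linear _ _ _ HU); lra.
  - exists (C / delta + 1); split.
    { pose proof (Rle_mult_inv_pos C delta C_nonneg delta_pos); unfold Rdiv; lra. }
    intros x; apply Rle_trans with (C * norm x / delta).
    + apply (norm_integral_to_infinity (fun t => U t x)); auto.
      * apply Rmult_le_pos; [exact C_nonneg | apply norm_ge_0].
      * intros t Ht; now apply (decaying_bound _ _ _ HU).
      * apply orbit_integral_correct.
    + pose proof (norm_ge_0 x).
      replace (C * norm x / delta) with (C / delta * norm x) by (field; lra).
      lra.
Qed.

(** By the semigroup law, the orbit of [U h x] is the orbit of [x] shifted by
    [h]. *)
Lemma orbit_integral_shift h x : 0 <= h ->
  orbit_integral U (U h x) =
  minus (orbit_integral U x) (RInt (fun t => U t x) 0 h).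
Proof.
  intros Hh; apply: integral_to_infinity_unique; [apply orbit_integral_correct |].
  apply (integral_to_infinity_ext (fun t => U (t + h) x)).
  - intros t Ht; apply (decaying_plus _ _ _ HU); lra.
  - apply (integral_to_infinity_shift (fun t => U t x)); auto; apply orbit_integral_correct.
Qed.

Lemma filterlim_neg_average x :
  filterlim (fun h => opp (scal (/ h) (RInt (fun t => U t x) 0 h)))
    (at_right 0) (locally (opp x)).
Proof.
  apply: (filterlim_comp _ _ _ _ opp _ (locally x)); [| apply: filterlim_opp].
  apply: average_at_0.
  - apply orbit_integrable.
  - apply (decaying_zero _ _ _ HU).
  - apply orbit_at_0.
Qed.

(** With [A] the generator of [U], this is [A (J x) = - x]: the increment
    [U h (J x) - J x] is minus the integral of the orbit over [0, h]. *)
Lemma orbit_integral_derivative x :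
  filterlim
    (fun h => scal (/ h) (minus (U h (orbit_integral U x)) (orbit_integral U x)))
    (at_right 0) (locally (opp x)).
Proof.
  apply: filterlim_ext_loc; [| apply (filterlim_neg_average x)].
  exists (mkposreal 1 Rlt_0_1); intros h _ Hh.
  rewrite -(orbit_integral_commute (U h)).
  - rewrite orbit_integral_shift; [| lra].
    rewrite minus_minus_l; symmetry; apply: scal_opp_r.
  - apply (decaying_linear _ _ _ HU); lra.
  - intros t y Ht; rewrite -!(decaying_plus _ _ _ HU); try lra.
    by rewrite Rplus_comm.
Qed.

(** With [A] the generator of [U], this is [J (A x) = - x]: the same increment
    is the image under [J] of [U h x - x], and [J] is continuous. *)
Lemma orbit_integral_of_derivative x y :
  filterlim (fun h => scal (/ h) (minus (U h x) x)) (at_right 0) (locally y) ->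
  orbit_integral U y = opp x.
Proof.
  intros Hy.
  pose proof orbit_integral_linear as HJ.
  apply: (filterlim_locally_unique (F := at_right 0)
    (fun h => orbit_integral U (scal (/ h) (minus (U h x) x)))).
  - apply: (filterlim_comp _ _ _ _ (orbit_integral U) _ (locally y)); auto.
    now apply (linear_cont (orbit_integral U) y).
  - apply: filterlim_ext_loc; [| apply (filterlim_neg_average x)].
    exists (mkposreal 1 Rlt_0_1); intros h _ Hh.
    rewrite (linear_scal _ HJ) (linear_minus _ _ _ HJ) orbit_integral_shift; [| lra].
    rewrite minus_minus_l; symmetry; apply: scal_opp_r.
Qed.

End Decaying.

(** * Exponentials of scalars *)

Definition exponential {k : ground} (mu : scalars k) (t : R) : scalars k :=
  exp_scalar (mult mu (of_real t)).

Lemma scalars_mult_comm {k : ground} (a b : scalars k) : mult a b = mult b a.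
Proof. destruct k; [apply Rmult_comm | apply Cmult_comm]. Qed.

Lemma re_opp {k : ground} (mu : scalars k) : re (opp mu) = - re mu.
Proof. now destruct k. Qed.

Lemma exponential_opp {k : ground} (mu : scalars k) t :
  exp_scalar (opp (mult mu (of_real t))) = exponential (opp mu) t.
Proof. unfold exponential; now rewrite opp_mult_l. Qed.

Lemma complex_exponential (mu : C) t :
  exponential (k := ComplexScalars) mu t =
  (exp (Re mu * t) * cos (Im mu * t), exp (Re mu * t) * sin (Im mu * t)).
Proof.
  destruct mu as [a b]; rewrite /exponential /mult /= /Cmult /=.
  now replace (a * t - b * 0) with (a * t) by ring;
    replace (a * 0 + b * t) with (b * t) by ring.
Qed.

Lemma exponential_0 {k : ground} (mu : scalars k) : exponential mu 0 = one.
Proof.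
  destruct k.
  - rewrite /exponential /mult /= /mult /= Rmult_0_r; apply exp_0.
  - rewrite complex_exponential !Rmult_0_r exp_0 cos_0 sin_0 Rmult_0_r Rmult_1_r.
    reflexivity.
Qed.

Lemma exponential_plus {k : ground} (mu : scalars k) t s :
  exponential mu (t + s) = mult (exponential mu t) (exponential mu s).
Proof.
  destruct k.
  - rewrite /exponential /mult /= /mult /= Rmult_plus_distr_l; apply exp_plus.
  - rewrite !complex_exponential !Rmult_plus_distr_l exp_plus cos_plus sin_plus.
    rewrite /mult /= /Cmult /=; f_equal; ring.
Qed.

Lemma abs_exponential {k : ground} (mu : scalars k) t :
  abs (exponential mu t) = exp (re mu * t).
Proof.
  destruct k.
  - rewrite /exponential /mult /= /mult /= /abs /=.
    apply Rabs_pos_eq, Rlt_le, exp_pos.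
  - rewrite complex_exponential; change (Cmod (exp (Re mu * t) * cos (Im mu * t),
      exp (Re mu * t) * sin (Im mu * t)) = exp (Re mu * t)).
    rewrite /Cmod /=.
    set (r := exp (Re mu * t)); set (th := Im mu * t).
    replace (_ + _) with (Rsqr r * (Rsqr (sin th) + Rsqr (cos th)))
      by (unfold Rsqr; ring).
    rewrite sin2_cos2 Rmult_1_r; apply sqrt_Rsqr, Rlt_le, exp_pos.
Qed.

Lemma exponential_inv {k : ground} (mu : scalars k) t :
  mult (exponential mu t) (exponential (opp mu) t) = one.
Proof.
  replace (exponential (opp mu) t) with (exponential mu (- t)).
  - rewrite -exponential_plus Rplus_opp_r; apply exponential_0.
  - destruct k.
    + rewrite /exponential /mult /= /mult /= /opp /=; f_equal; ring.
    + rewrite !complex_exponential /=.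
      by rewrite /Re /Im /= -/(Re mu) -/(Im mu) !Ropp_mult_distr_l_reverse
        !Ropp_mult_distr_r_reverse.
Qed.

(** The uniform structure given by the modulus has the same neighbourhoods as
    the product structure. *)
Lemma filterlim_C_components {T : Type} (G : (T -> Prop) -> Prop)
    (FG : Filter G) (f : T -> C) (z : C) :
  filterlim (fun x => Re (f x)) G (locally (Re z)) ->
  filterlim (fun x => Im (f x)) G (locally (Im z)) ->
  filterlim f G (locally (T := AbsRing_UniformSpace C_AbsRing) z).
Proof.
  intros Hre Him P HP.
  apply locally_C in HP; destruct HP as [eps Heps].
  assert (Hr : G (fun x => ball (Re z) eps (Re (f x))))
    by exact (Hre _ (locally_ball (Re z) eps)).
  assert (Hi : G (fun x => ball (Im z) eps (Im (f x))))
    by exact (Him _ (locally_ball (Im z) eps)).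
  change (G (fun x => P (f x))); generalize (filter_and _ _ Hr Hi).
  apply filter_imp; intros x H; apply Heps; exact H.
Qed.

Lemma exponential_continuous {k : ground} (mu : scalars k) t :
  filterlim (exponential mu) (locally t) (locally (exponential mu t)).
Proof.
  destruct k.
  - apply: (ex_derive_continuous (fun t => exp (mu * t))); auto_derive; trivial.
  - apply filterlim_C_components; [apply _ | |].
    + apply (filterlim_ext (fun t => exp (Re mu * t) * cos (Im mu * t))).
      { intros s; now rewrite complex_exponential. }
      rewrite complex_exponential.
      apply: (ex_derive_continuous (fun t => exp (Re mu * t) * cos (Im mu * t))).
      auto_derive; trivial.
    + apply (filterlim_ext (fun t => exp (Re mu * t) * sin (Im mu * t))).
      { intros s; now rewrite complex_exponential. }
      rewrite complex_exponential.
      apply: (ex_derive_continuous (fun t => exp (Re mu * t) * sin (Im mu * t))).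
      auto_derive; trivial.
Qed.

Lemma difference_quotient_at_0 (f : R -> R) (l : R) : is_derive f 0 l ->
  filterlim (fun h => / h * (f h - f 0)) (at_right 0) (locally l).
Proof.
  intros Hf; apply is_derive_Reals in Hf.
  apply filterlim_locally; intros eps.
  destruct (Hf eps (cond_pos eps)) as [d Hd].
  exists d; intros h Hh Hh0.
  specialize (Hd h); rewrite Rplus_0_l in Hd.
  rewrite Rmult_comm; apply Hd; [lra |].
  revert Hh; rewrite /ball /= /AbsRing_ball /minus /plus /opp /abs /=.
  by rewrite Ropp_0 Rplus_0_r.
Qed.

Lemma exponential_derivative {k : ground} (mu : scalars k) :
  filterlim (fun h => mult (of_real (/ h)) (minus (exponential mu h) one))
    (at_right 0) (locally mu).
Proof.
  destruct k.
  - apply (filterlim_ext (fun h => / h * (exp (mu * h) - exp (mu * 0)))).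
    { intros h; by rewrite Rmult_0_r exp_0. }
    apply (difference_quotient_at_0 (fun h => exp (mu * h))).
    auto_derive; trivial; rewrite Rmult_0_r exp_0; ring.
  - apply filterlim_C_components; [apply _ | |].
    + apply (filterlim_ext (fun h => / h * (exp (Re mu * h) * cos (Im mu * h)
        - exp (Re mu * 0) * cos (Im mu * 0)))).
      { intros h; rewrite complex_exponential !Rmult_0_r exp_0 cos_0 /=; ring. }
      apply (difference_quotient_at_0 (fun h => exp (Re mu * h) * cos (Im mu * h))).
      auto_derive; trivial; rewrite !Rmult_0_r exp_0 cos_0 sin_0; ring.
    + apply (filterlim_ext (fun h => / h * (exp (Re mu * h) * sin (Im mu * h)
        - exp (Re mu * 0) * sin (Im mu * 0)))).
      { intros h; rewrite complex_exponential !Rmult_0_r exp_0 sin_0 /=; ring. }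
      apply (difference_quotient_at_0 (fun h => exp (Re mu * h) * sin (Im mu * h))).
      auto_derive; trivial; rewrite !Rmult_0_r exp_0 cos_0 sin_0; ring.
Qed.

(** * Bounded operators and their norms *)

Section Operators.
Context {k : ground} {F : Banach k}.
Implicit Types (A : F -> F) (x : F).

Lemma is_linear_realify A : is_linear A ->
  is_linear (K := R_AbsRing) (U := realify F) (V := realify F) A.
Proof.
  intros HA; split.
  - exact (linear_plus _ HA).
  - intros r x; exact (linear_scal _ HA (of_real r) x).
  - exact (linear_norm _ HA).
Qed.

Lemma is_linear_scal (c : scalars k) : is_linear (fun x : F => scal c x).
Proof. exact (is_linear_scal_r (V := F) c scalars_mult_comm). Qed.

Lemma is_linear_iter A n : is_linear A -> is_linear (Nat.iter n A).
Proof.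
  intros HA; induction n as [| n IH].
  - apply is_linear_id.
  - now apply (is_linear_comp (Nat.iter n A) A).
Qed.

Lemma norm_le_op_norm_unit A (c : R) x : Rbar_le (op_norm A) c -> norm x <= 1 ->
  norm (A x) <= c.
Proof.
  intros Hc Hx; change (Rbar_le (norm (A x)) c).
  apply Rbar_le_trans with (op_norm A); auto.
  apply (proj1 (Lub_Rbar_correct _)); now exists x.
Qed.

(** Linearity turns the bound on the unit ball into a bound proportional to
    the norm, by normalizing [x]. *)
Lemma norm_le_op_norm A (c : R) x : is_linear A -> Rbar_le (op_norm A) c ->
  norm (A x) <= c * norm x.
Proof.
  intros HA Hc.
  destruct (Req_dec (norm x) 0) as [Hx | Hx].
  - rewrite Hx Rmult_0_r (norm_eq_zero _ Hx) (linear_zero _ HA) norm_zero.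
    apply Rle_refl.
  - assert (Hpos : 0 < norm x) by (pose proof (norm_ge_0 x); lra).
    set (y := scal (of_real (/ norm x)) x).
    assert (Hy : norm y <= 1).
    { eapply Rle_trans; [apply (norm_scal (V := F)) |].
      rewrite abs_of_real Rabs_pos_eq; [| now apply Rlt_le, Rinv_0_lt_compat].
      rewrite Rinv_l; lra. }
    pose proof (norm_le_op_norm_unit A c y Hc Hy) as HAy.
    assert (Hx' : A x = scal (of_real (norm x)) (A y)).
    { rewrite -(linear_scal _ HA) /y scal_assoc -of_real_mult Rinv_r; auto.
      by rewrite of_real_one scal_one. }
    rewrite Hx'; eapply Rle_trans; [apply (norm_scal (V := F)) |].
    rewrite abs_of_real Rabs_pos_eq; [| lra].
    rewrite (Rmult_comm c); apply Rmult_le_compat_l; lra.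
Qed.

Lemma op_norm_le A (c : R) : (forall x, norm x <= 1 -> norm (A x) <= c) ->
  Rbar_le (op_norm A) c.
Proof.
  intros H; apply (proj2 (Lub_Rbar_correct _)).
  intros r [x [Hx ->]]; now apply H.
Qed.

(** The value at zero already contributes to the supremum. *)
Lemma op_norm_ge_0 A : Rbar_le 0 (op_norm A).
Proof.
  apply Rbar_le_trans with (norm (A zero)); [apply norm_ge_0 |].
  apply (proj1 (Lub_Rbar_correct _)); exists zero; split; auto.
  rewrite norm_zero; lra.
Qed.

Lemma le_of_sup_on_lt T (g : R -> Rbar) (c : Rbar) t :
  Rbar_lt (sup_on T g) c -> 0 <= t <= T -> Rbar_le (g t) c.
Proof.
  intros H Ht; apply Rbar_le_trans with (sup_on T g); [| now apply Rbar_lt_le].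
  apply (proj1 (proj2_sig (Rbar_ex_lub _))); now exists t.
Qed.

(** * The resolvent as a Laplace transform *)

(** The product rule at time zero: multiplying by [exp (mu h)] adds [mu] to the
    generator.  With [mu = - lam] it leads from [V] to [U], with [mu = lam]
    back. *)
Lemma derivative_rescaled (W : R -> F -> F) (mu : scalars k) x y :
  filterlim (fun h => scal (of_real (/ h)) (minus (W h x) x))
    (at_right 0) (locally y) ->
  filterlim
    (fun h => scal (of_real (/ h)) (minus (scal (exponential mu h) (W h x)) x))
    (at_right 0) (locally (plus y (scal mu x))).
Proof.
  intros HW.
  apply filterlim_ext with (fun h =>
    plus (scal (exponential mu h) (scal (of_real (/ h)) (minus (W h x) x)))
         (scal (mult (of_real (/ h)) (minus (exponential mu h) one)) x)).
  - intros h.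
    rewrite scal_assoc scalars_mult_comm -!scal_assoc -scal_distr_l; f_equal.
    rewrite scal_minus_distr_l scal_minus_distr_r scal_one.
    symmetry; apply: minus_trans.
  - apply (filterlim_comp_2 (G := locally y) (H := locally (scal mu x)));
      [| | apply: filterlim_plus].
    + assert (Hexp : filterlim (exponential mu) (at_right 0)
        (locally (one : scalars k))).
      { rewrite -(exponential_0 mu).
        apply: filterlim_filter_le_1; [| apply: exponential_continuous].
        apply filter_le_within. }
      rewrite -(scal_one y).
      apply: (filterlim_comp_2 _ _ scal Hexp HW); apply: filterlim_scal.
    + apply: (filterlim_comp _ _ _ _ (fun c => scal c x) _ (locally mu)).
      * apply exponential_derivative.
      * apply: filterlim_scal_l.
Qed.

End Operators.

Lemma resolvent_unique {k : ground} {F : Banach k} (D : F -> Prop) (L : F -> F)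
    (lam : scalars k) (A B : F -> F) f :
  is_resolvent D L lam A -> is_resolvent D L lam B -> A f = B f.
Proof.
  intros (_ & _ & HA) (_ & HB & _).
  destruct (HB f) as [HD Hf]; rewrite -{1}Hf; auto.
Qed.

(** The semigroup generated by [L - lam], seen on the underlying real space. *)
Definition rescaled {k : ground} {F : Banach k} (lam : scalars k)
    (V : R -> F -> F) (t : R) : realify F -> realify F :=
  fun x => scal (exponential (opp lam) t) (V t x : F).

Section Resolvent.
Context {k : ground} {F : Banach k} (D : F -> Prop) (L : F -> F).
Context (V : R -> F -> F) (M omega : R) (lam : scalars k).
Context (HV : C0_semigroup V) (HL : is_generator V D L).
Context (HM : 1 <= M) (Hlam : omega < re lam).
Context (HVM : forall t, 0 <= t -> Rbar_le (op_norm (V t)) (M * exp (omega * t))).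

(** Shared by the semigroup and its Chernoff approximations, which satisfy the
    same growth bound. *)
Lemma norm_rescaled_le t (x y : F) (c : R) : 0 <= t ->
  norm y <= M * exp (omega * t) * c ->
  norm (scal (exponential (opp lam) t) y) <=
    M * c * exp (- ((re lam - omega) * t)).
Proof.
  intros Ht Hy; eapply Rle_trans; [apply (norm_scal (V := F)) |].
  rewrite abs_exponential re_opp.
  replace (- ((re lam - omega) * t)) with (- re lam * t + omega * t) by ring.
  rewrite exp_plus.
  replace (M * c * _) with (exp (- re lam * t) * (M * exp (omega * t) * c)) by ring.
  apply Rmult_le_compat_l; auto; apply Rlt_le, exp_pos.
Qed.

Lemma rescaled_decaying :
  decaying_semigroup (rescaled lam V) M (re lam - omega).
Proof.
  split.
  - intros t Ht; apply is_linear_realify.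
    apply (is_linear_comp (V t) (fun y => scal (exponential (opp lam) t) y)).
    + now apply C0_bounded.
    + apply is_linear_scal.
  - intros x; rewrite /rescaled exponential_0 (C0_zero _ HV).
    exact (scal_one (x : F)).
  - intros t s Ht Hs x; rewrite /rescaled (C0_plus _ HV _ _ Ht Hs).
    rewrite exponential_plus -scal_assoc.
    by rewrite (linear_scal _ (C0_bounded _ HV t Ht)).
  - intros x t Ht; unfold rescaled.
    apply: (filterlim_comp_2 _ _ scal _ (C0_continuous _ HV x t Ht)
              (filterlim_scal (V := F) (exponential (opp lam) t) (V t x))).
    apply: filterlim_filter_le_1; [| apply: exponential_continuous].
    apply filter_le_within.
  - intros t x Ht; apply norm_rescaled_le; auto.
    apply norm_le_op_norm; [now apply (C0_bounded _ HV) | auto].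
Qed.

Let J : F -> F := orbit_integral (rescaled lam V).

(** The two one-sided inverse properties are the two limits for the rescaled
    semigroup, translated back through [derivative_rescaled]. *)
Lemma laplace_semigroup_resolvent : is_resolvent D L lam J.
Proof.
  assert (Hd : 0 < re lam - omega) by lra.
  assert (HM0 : 0 <= M) by lra.
  pose proof rescaled_decaying as HU.
  pose proof (orbit_integral_linear _ _ _ Hd HM0 HU) as HJ.
  assert (HJk : is_linear J).
  { split.
    - exact (linear_plus _ HJ).
    - intros a x.
      apply (orbit_integral_commute _ _ _ Hd HM0 HU (fun y : F => scal a y)).
      + apply is_linear_realify, is_linear_scal.
      + intros t y Ht; unfold rescaled.
        rewrite (linear_scal _ (C0_bounded _ HV t (Rlt_le _ _ Ht))).
        by rewrite !scal_assoc scalars_mult_comm.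
    - exact (linear_norm _ HJ). }
  split; [exact HJk | split].
  - intros f.
    assert (Hder : filterlim (fun t => scal (of_real (k := k) (/ t))
        (minus (V t (J f)) (J f))) (at_right 0)
        (locally (plus (opp f) (scal lam (J f))))).
    (* [V h] is recovered as [exp (lam h) U h]. *)
    { apply (filterlim_ext (fun h => scal (of_real (k := k) (/ h))
        (minus (scal (exponential lam h) (rescaled lam V h (J f) : F)) (J f)))).
      - intros h; unfold rescaled.
        by rewrite scal_assoc exponential_inv scal_one.
      - apply (derivative_rescaled (rescaled lam V)).
        exact (orbit_integral_derivative _ _ _ Hd HM0 HU f). }
    destruct HL as [HD HLx].
    assert (HDJ : D (J f)) by (apply HD; eauto).
    split; [exact HDJ |].
    rewrite (filterlim_locally_unique _ _ _ (HLx _ HDJ) Hder).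
    rewrite /minus opp_plus opp_opp (plus_comm f) plus_assoc plus_opp_r.
    apply plus_zero_l.
  - intros x Hx.
    pose proof (derivative_rescaled V (opp lam) x (L x) (proj2 HL x Hx)) as Hder.
    pose proof (orbit_integral_of_derivative _ _ _ Hd HM0 HU _ _ Hder) as HJx.
    change (J (plus (L x) (scal (opp lam) x)) = opp x) in HJx.
    replace (minus (scal lam x) (L x)) with (opp (plus (L x) (scal (opp lam) x))).
    + rewrite (linear_opp _ _ HJk) HJx; exact (opp_opp (x : F)).
    + rewrite scal_opp_l; apply: opp_minus.
Qed.

(** * Laplace transforms of the Chernoff approximations *)

Context (S : R -> F -> F) (Homega : 0 <= omega).
Context (HS : forall t, 0 <= t -> is_linear (S t)).
Context (HSM : forall (t : R) (j : nat), 0 <= t -> (1 <= j)%nat ->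
  Rbar_le (op_norm (Nat.iter j (S t))) (M * exp (omega * t * INR j))).

(** For [n = 0] the step is zero, because the inverse of zero is zero. *)
Lemma time_step_ge_0 n t : 0 <= t -> 0 <= t / INR n.
Proof.
  intros Ht; destruct n as [| n].
  - unfold Rdiv; simpl; rewrite Rinv_0; lra.
  - apply Rle_mult_inv_pos; auto; apply lt_0_INR; lia.
Qed.

Lemma chernoff_linear n t : 0 <= t -> is_linear (chernoff S n t).
Proof. intros Ht; apply is_linear_iter, HS; now apply time_step_ge_0. Qed.

(** The [n]-th power at time [t / n] has total time [t], so the growth bound
    does not depend on [n]. *)
Lemma norm_chernoff_le n t x : (1 <= n)%nat -> 0 <= t ->
  norm (chernoff S n t x) <= M * exp (omega * t) * norm x.
Proof.
  intros Hn Ht; apply norm_le_op_norm; [now apply chernoff_linear |].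
  assert (Hn0 : INR n <> 0) by (apply not_0_INR; lia).
  replace (omega * t) with (omega * (t / INR n) * INR n) by (field; auto).
  apply HSM; auto; now apply time_step_ge_0.
Qed.

Lemma norm_laplace_integrand_le n f t : (1 <= n)%nat -> 0 <= t ->
  norm (laplace_integrand lam S n f t) <=
    M * norm f * exp (- ((re lam - omega) * t)).
Proof.
  intros Hn Ht; rewrite /laplace_integrand exponential_opp.
  apply norm_rescaled_le; auto; now apply norm_chernoff_le.
Qed.

Lemma laplace_correct n f : (1 <= n)%nat -> locally_integrable lam S n f ->
  integral_to_infinity (laplace_integrand lam S n f) (laplace lam S n f).
Proof.
  intros Hn Hf.
  destruct (exp_decay_integrable (laplace_integrand lam S n f) (M * norm f)
    (re lam - omega)) as [l Hl].
  - lra.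
  - apply Rmult_le_pos; [lra | apply norm_ge_0].
  - exact Hf.
  - intros t Ht; now apply norm_laplace_integrand_le.
  - unfold laplace; now rewrite (integral_to_infinity_RInt_gen _ _ Hl).
Qed.

Lemma laplace_converges_of_integrable n f : (1 <= n)%nat ->
  locally_integrable lam S n f -> laplace_converges lam S n f.
Proof.
  intros Hn Hf; exists (laplace lam S n f).
  now apply integral_to_infinity_gen, laplace_correct.
Qed.

Lemma laplace_linear n : (1 <= n)%nat ->
  (forall f, locally_integrable lam S n f) -> is_linear (laplace lam S n).
Proof.
  intros Hn Hf; split.
  - intros x y.
    apply (integral_to_infinity_unique (E := realify F)
      (laplace_integrand lam S n (plus x y))); [now apply laplace_correct |].
    apply (integral_to_infinity_ext (fun t =>
      plus (laplace_integrand lam S n x t) (laplace_integrand lam S n y t))).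
    + intros t Ht; unfold laplace_integrand.
      rewrite (linear_plus _ (chernoff_linear n t (Rlt_le _ _ Ht))).
      symmetry; exact (scal_distr_l (V := F) _ _ _).
    + apply (integral_to_infinity_plus (laplace_integrand lam S n x)
        (laplace_integrand lam S n y)); now apply laplace_correct.
  - intros a x.
    apply (integral_to_infinity_unique (E := realify F)
      (laplace_integrand lam S n (scal a x))); [now apply laplace_correct |].
    apply (integral_to_infinity_ext (fun t =>
      scal a (laplace_integrand lam S n x t : F) : realify F)).
    + intros t Ht; unfold laplace_integrand.
      rewrite (linear_scal _ (chernoff_linear n t (Rlt_le _ _ Ht))).
      by rewrite !scal_assoc scalars_mult_comm.
    + apply (integral_to_infinity_linear (E := realify F) (fun y : F => scal a y)).
      * apply is_linear_realify, is_linear_scal.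
      * now apply laplace_correct.
  - exists (M / (re lam - omega)); split.
    { apply Rdiv_lt_0_compat; lra. }
    intros x.
    replace (_ * norm x) with (M * norm x / (re lam - omega)) by (field; lra).
    apply (norm_integral_to_infinity (E := realify F)
      (laplace_integrand lam S n x)).
    + lra.
    + apply Rmult_le_pos; [lra | apply norm_ge_0].
    + intros t Ht; now apply norm_laplace_integrand_le.
    + now apply laplace_correct.
Qed.

(** The right-hand side separates [n], which enters through [eta], from the
    tail, which is governed by [T]; it is also monotone in [norm f], hence
    uniform over the unit ball. *)
Lemma laplace_error n f T eta : (1 <= n)%nat -> locally_integrable lam S n f ->
  0 <= T ->
  (forall t, 0 <= t <= T -> norm (minus (V t f) (chernoff S n t f)) <= eta) ->
  norm (minus (J f) (laplace lam S n f)) <=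
    T * eta + 2 * (M * norm f / (re lam - omega)) * exp (- ((re lam - omega) * T)).
Proof.
  intros Hn Hf HT Heta.
  pose proof rescaled_decaying as HU.
  apply (norm_integral_to_infinity_minus (E := realify F)
    (fun t => rescaled lam V t f) (laplace_integrand lam S n f)).
  - lra.
  - apply Rmult_le_pos; [lra | apply norm_ge_0].
  - exact HT.
  - intros t Ht; now apply (decaying_bound _ _ _ HU).
  - intros t Ht; now apply norm_laplace_integrand_le.
  - intros t Ht; rewrite /rescaled /laplace_integrand exponential_opp.
    change (norm (minus (scal (exponential (opp lam) t) (V t f))
      (scal (exponential (opp lam) t) (chernoff S n t f))) <= eta).
    rewrite -scal_minus_distr_l.
    eapply Rle_trans; [apply (norm_scal (V := F)) |].
    apply Rle_trans with (1 * norm (minus (V t f) (chernoff S n t f))).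
    + apply Rmult_le_compat_r; [apply norm_ge_0 |].
      rewrite abs_exponential re_opp -exp_0.
      assert (Hle : - re lam * t <= 0)
        by (assert (0 <= re lam * t) by (apply Rmult_le_pos; lra); lra).
      destruct Hle as [Hlt | ->];
        [now apply Rlt_le, exp_increasing | apply Rle_refl].
    + rewrite Rmult_1_l; now apply Heta.
  - apply (orbit_integral_correct _ M (re lam - omega)); auto; lra.
  - now apply laplace_correct.
Qed.

End Resolvent.

(** The length [T] is chosen first, to make the tail small, and only then the
    accuracy [eta] on [0, T], which has to beat the factor [T]. *)
Lemma split_error K delta eps : 0 < delta -> 0 <= K -> 0 < eps ->
  exists T eta, 0 < T /\ 0 < eta /\
    T * eta + 2 * K * exp (- (delta * T)) < eps.
Proof.
  intros Hd HK He.
  destruct (exp_decay_small (2 * K) delta (eps / 2)) as (T & HT & Hsmall); try lra.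
  exists T, (eps / 2 / T); repeat split; auto.
  - apply Rdiv_lt_0_compat; lra.
  - specialize (Hsmall T (Rle_refl T)).
    replace (T * (eps / 2 / T)) with (eps / 2) by (field; lra); lra.
Qed.

Theorem theorem3 :
  forall (k : ground) (F : Banach k)
    (D : F -> Prop) (L : F -> F) (V S : R -> F -> F) (M omega : R)
    (lam : scalars k),
  C0_semigroup V ->
  is_generator V D L ->
  1 <= M ->
  0 <= omega ->
  (forall t, 0 <= t -> Rbar_le (op_norm (V t)) (M * exp (omega * t))) ->
  (forall t, 0 <= t -> is_linear (S t)) ->
  (forall (t : R) (j : nat), 0 <= t -> (1 <= j)%nat ->
     Rbar_le (op_norm (Nat.iter j (S t))) (M * exp (omega * t * INR j))) ->
  omega < re lam ->
  resolvent_set D L lam /\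
  forall Rlam : F -> F, is_resolvent D L lam Rlam ->
    ((forall T, 0 < T -> forall f : F,
        tends_to_0 (fun n =>
          sup_on T (fun t => norm (minus (V t f) (chernoff S n t f))))) ->
     forall f : F,
       eventually (fun n => locally_integrable lam S n f) ->
       eventually (fun n => laplace_converges lam S n f) /\
       is_lim_seq (fun n => norm (minus (Rlam f) (laplace lam S n f))) 0)
    /\
    ((forall T, 0 < T ->
        tends_to_0 (fun n =>
          sup_on T (fun t => op_norm (op_minus (V t) (chernoff S n t))))) ->
     eventually (fun n => forall f : F, locally_integrable lam S n f) ->
     eventually (fun n =>
       (forall f : F, laplace_converges lam S n f) /\
       is_linear (laplace lam S n)) /\
     tends_to_0 (fun n => op_norm (op_minus Rlam (laplace lam S n)))).
Proof.
  intros k F D L V S M omega lam HV HL HM Homega HVM HS HSM Hlam.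
  pose proof (laplace_semigroup_resolvent D L V M omega lam HV HL HM Hlam HVM)
    as HJ.
  split; [eexists; exact HJ |].
  intros Rlam HR.
  assert (HRJ : forall f, Rlam f = orbit_integral (rescaled lam V) f)
    by (intros f; exact (resolvent_unique D L lam _ _ f HR HJ)).
  assert (Herr : forall n f T eta, (1 <= n)%nat -> locally_integrable lam S n f ->
    0 < T ->
    (forall t, 0 <= t <= T -> norm (minus (V t f) (chernoff S n t f)) <= eta) ->
    norm (minus (Rlam f) (laplace lam S n f)) <= T * eta +
      2 * (M * norm f / (re lam - omega)) * exp (- ((re lam - omega) * T))).
  { intros n f T eta Hn Hf HT Heta; rewrite HRJ.
    apply laplace_error; auto; lra. }
  assert (Hpos : eventually (fun n => (1 <= n)%nat)) by now exists 1%nat.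
  split.
  - intros Hconv f Hf; split.
    { generalize (filter_and _ _ Hpos Hf); apply filter_imp; intros n [Hn Hfn].
      now apply (laplace_converges_of_integrable M omega lam). }
    apply is_lim_seq_spec; intros eps.
    destruct (split_error (M * norm f / (re lam - omega)) (re lam - omega) eps)
      as (T & eta & HT & Heta & Hlt).
    { lra. }
    { apply Rle_mult_inv_pos; [| lra]; apply Rmult_le_pos; [lra | apply norm_ge_0]. }
    { apply cond_pos. }
    generalize (filter_and _ _ (filter_and _ _ Hpos Hf)
      (Hconv T HT f (mkposreal eta Heta))).
    apply filter_imp; intros n [[Hn Hfn] [_ Hsup]].
    rewrite Rminus_0_r Rabs_pos_eq; [| apply norm_ge_0].
    eapply Rle_lt_trans; [| exact Hlt].
    apply Herr; auto; intros t Ht.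
    exact (le_of_sup_on_lt T _ _ t Hsup Ht).
  - intros Hconv Hint; split.
    { generalize (filter_and _ _ Hpos Hint); apply filter_imp; intros n [Hn Hfn].
      split.
      - intros f; now apply (laplace_converges_of_integrable M omega lam).
      - now apply (laplace_linear M omega lam). }
    intros eps.
    destruct (split_error (M / (re lam - omega)) (re lam - omega) eps)
      as (T & eta & HT & Heta & Hlt).
    { lra. }
    { apply Rle_mult_inv_pos; lra. }
    { apply cond_pos. }
    generalize (filter_and _ _ (filter_and _ _ Hpos Hint)
      (Hconv T HT (mkposreal eta Heta))).
    apply filter_imp; intros n [[Hn Hfn] [_ Hsup]]; split.
    + apply Rbar_lt_le_trans with 0; [| apply op_norm_ge_0].
      simpl; pose proof (cond_pos eps); lra.
    + eapply Rbar_le_lt_trans; [apply op_norm_le | exact Hlt].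
      intros x Hx; unfold op_minus.
      eapply Rle_trans; [apply (Herr n x T eta); auto |].
      * intros t Ht.
        apply (norm_le_op_norm_unit (op_minus (V t) (chernoff S n t))); auto.
        exact (le_of_sup_on_lt T _ _ t Hsup Ht).
      * apply Rplus_le_compat_l, Rmult_le_compat_r; [apply Rlt_le, exp_pos |].
        apply Rmult_le_compat_l; [lra |].
        apply Rmult_le_compat_r; [apply Rlt_le, Rinv_0_lt_compat; lra |].
        rewrite -{2}(Rmult_1_r M); apply Rmult_le_compat_l; lra.
Qed.
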